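(* No algorithm can solve unweighted sorted-no-self-APSD enumeration with both delay and preprocessing in $o(n)$.
   Context: Input: an unweighted graph $G=(V,E)$ with $n$ vertices given as read-only adjacency lists, accessed via degree and next-neighbor queries. $d(u,v)$ is the hop distance ($\infty$ if unreachable). Sorted-no-self-APSD enumeration: output each triple $(u,v,d(u,v))$ with $u\neq v$ exactly once, in nondecreasing order of $d(u,v)$. Preprocessing: time before enumeration starts; delay: maximum time to the first output after preprocessing, between consecutive outputs, and until termination is signalled. *)

(* Defs.v *)
From mathcomp Require Import all_boot all_order all_algebra.
From mathcomp Require Import all_classical all_reals all_analysis.

Set Implicit Arguments.
Unset Strict Implicit.
Unset Printing Implicit Defensive.

(* A simple undirected graph on 'I_n together with the adjacency lists that
   represent it; each list may come in any order. *)
Record graph (n : nat) := Graph {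
  adj : 'I_n -> seq 'I_n;
  adj_uniq : forall v, uniq (adj v);
  adj_sym : forall u v, (u \in adj v) = (v \in adj u);
  adj_irrefl : forall v, v \notin adj v
}.

Section Distance.
Variables (n : nat) (G : graph n).

Definition edge : rel 'I_n := fun u v => v \in adj G u.

Definition has_walk (u v : 'I_n) (k : nat) : bool :=
  [exists p : k.-tuple 'I_n, path edge u p && (last u p == v)].

(* Hop distance; None stands for infinity. *)
Definition dist (u v : 'I_n) : option nat :=
  match pselect (exists k, has_walk u v k) with
  | left ex_walk => Some (ex_minn ex_walk)
  | right _ => None
  end.

End Distance.

Definition dist_le (d e : option nat) : bool :=
  match d, e with
  | _, None => true
  | None, Some _ => false
  | Some a, Some b => a <= b
  end.

Definition triple (n : nat) : Type := ('I_n * 'I_n * option nat)%type.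

(* The list s is a valid output of sorted-no-self-APSD on G; pairs of vertices
   are ordered pairs. *)
Definition sorted_no_self_APSD (n : nat) (G : graph n) (s : seq (triple n)) :
    Prop :=
  [/\ uniq s,
      (forall u v d, ((u, v, d) \in s) <-> (u != v /\ d = dist G u v))
    & sorted dist_le [seq t.2 | t <- s]].

(* One time unit of a computation with internal states in S. Each action
   touches the input at most once, through a query. The states and the
   transitions between them are arbitrary, so that the steps of any RAM
   program reading the input through these queries are among those allowed.
   StartEnum marks the end of the preprocessing. *)
Inductive action (n : nat) (S : Type) : Type :=
| Compute of S
| Degree of 'I_n & (nat -> S)
| NextNeighbor of 'I_n & option 'I_n & (option 'I_n -> S)
| StartEnum of S
| Output of triple n & S
| Halt.

Record machine (n : nat) := Machine {
  state : Type;
  init : state;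
  step : state -> action n state
}.

(* An algorithm is told the number of vertices, but nothing else about the
   graph. *)
Definition algorithm : Type := forall n : nat, machine n.

(* The entry that follows w in the adjacency list of v, or the first one when w
   is None; the answer None signals the end of the list. As the entries of a
   list are distinct, w identifies a position in it, so that several traversals
   of the same list can be interleaved. *)
Definition next_neighbor (n : nat) (G : graph n) (v : 'I_n) (w : option 'I_n) :
    option 'I_n :=
  match w with
  | None => onth (adj G v) 0
  | Some u => onth (adj G v) (index u (adj G v)).+1
  end.

Inductive event (n : nat) : Type :=
| Tick
| Started
| Emitted of triple n
| Halted.

Arguments Tick {n}.
Arguments Started {n}.
Arguments Halted {n}.

Definition is_tick (n : nat) (e : event n) : bool :=
  if e is Tick then true else false.

Definition is_started (n : nat) (e : event n) : bool :=
  if e is Started then true else false.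

(* run G s tr: started in state s on input G, the machine terminates, and tr
   lists what happens in each time unit, up to the halting one. *)
Inductive run (n : nat) (M : machine n) (G : graph n) :
    state M -> seq (event n) -> Prop :=
| RunCompute s s' tr :
    step s = Compute n s' -> run G s' tr -> run G s (Tick :: tr)
| RunDegree s v k tr :
    step s = Degree v k -> run G (k (size (adj G v))) tr ->
    run G s (Tick :: tr)
| RunNextNeighbor s v w k tr :
    step s = NextNeighbor v w k -> run G (k (next_neighbor G v w)) tr ->
    run G s (Tick :: tr)
| RunStartEnum s s' tr :
    step s = StartEnum n s' -> run G s' tr -> run G s (Started :: tr)
| RunOutput s t s' tr :
    step s = Output t s' -> run G s' tr -> run G s (Emitted t :: tr)
| RunHalt s : step s = Halt n (state M) -> run G s [:: Halted].

Definition execution (A : algorithm) (n : nat) (G : graph n)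
    (tr : seq (event n)) : Prop :=
  run G (init (A n)) tr.

(* Apart from ticks, a correct execution consists of the end of the
   preprocessing, then the outputs, then the termination signal. *)
Definition solves_sorted_no_self_APSD (A : algorithm) : Prop :=
  forall (n : nat) (G : graph n),
    exists (tr : seq (event n)) (s : seq (triple n)),
      [/\ execution A G tr,
          [seq e <- tr | ~~ is_tick e] =
            Started :: rcons (map (@Emitted n) s) Halted
        & sorted_no_self_APSD G s].

Definition preprocessing_time (n : nat) (tr : seq (event n)) : nat :=
  find (@is_started n) tr.

Definition milestones (n : nat) (tr : seq (event n)) : seq nat :=
  [seq i <- iota 0 (size tr) | ~~ is_tick (nth Tick tr i)].

(* The largest gap between consecutive milestones: end of the preprocessing to
   first output, output to next output, last output to termination. *)
Definition delay (n : nat) (tr : seq (event n)) : nat :=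
  \max_(p <- zip (milestones tr) (behead (milestones tr))) (p.2 - p.1).

Definition preprocessing_bound (A : algorithm) (f : nat -> nat) : Prop :=
  forall (n : nat) (G : graph n) (tr : seq (event n)),
    execution A G tr -> preprocessing_time tr <= f n.

Definition delay_bound (A : algorithm) (f : nat -> nat) : Prop :=
  forall (n : nat) (G : graph n) (tr : seq (event n)),
    execution A G tr -> delay tr <= f n.

(* Main.v *)
Require Import Defs.
From mathcomp Require Import all_boot all_order all_algebra.
From mathcomp Require Import all_classical all_reals all_analysis.
From mathcomp Require Import zify lra.
Import numFieldNormedType.Exports.
Import GRing.Theory Num.Theory.

(** Adversary argument. On the edgeless graph the first output is a triple
    (u, v, oo), and it is made after o(n) time units, hence after o(n) queries.
    So for large n two vertices a and b have not been queried by then. Adding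
    the edge ab does not change the computation up to the first output, but
    there the pair (a, b) at finite distance has to be output first. *)

Definition empty_graph (n : nat) : graph n.
Proof. by refine (@Graph n (fun _ => [::]) _ _ _). Defined.

Definition single_edge (n : nat) (a b : 'I_n) (ab : a != b) : graph n.
Proof.
refine (@Graph n (fun v => if v == a then [:: b]
                           else if v == b then [:: a] else [::]) _ _ _).
- by move=> v; do 2?case: ifP.
- move=> u v; have [->|ua] := eqVneq u a; have [->|va] := eqVneq v a => //.
  + by rewrite inE; case: ifP; rewrite !inE ?eqxx.
  + by rewrite inE; case: ifP; rewrite !inE ?eqxx.
  + by case: ifP => vb; case: ifP => ub; rewrite !inE ?(negbTE ua) ?(negbTE va).
- move=> v; case: eqVneq => [->|_]; first by rewrite inE.
  by case: eqVneq => [->|//]; rewrite inE eq_sym.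
Defined.

Lemma dist_empty_graph (n : nat) (u v : 'I_n) :
  u != v -> dist (empty_graph n) u v = None.
Proof.
rewrite /dist => uv; case: pselect => // walk; exfalso.
case: walk => k /existsP[p].
by case: (tval p) => [|w q]; rewrite /= /edge ?in_nil //= (negbTE uv).
Qed.

Lemma dist_edge (n : nat) (G : graph n) (u v : 'I_n) :
  edge G u v -> dist G u v <> None.
Proof.
rewrite /dist => uv; case: pselect => // -[].
by exists 1; apply/existsP; exists [tuple v]; rewrite /= uv eqxx.
Qed.

(** [Q] collects the vertices queried in the first [k] time units on [G], at most one per unit. A
    graph with the same lists on [Q] gives the same answers, hence the same states and events. *)
Lemma run_agree (n : nat) (M : machine n) (G : graph n) (s : state M)
    (tr : seq (event n)) (k : nat) :
  run G s tr ->
  exists Q : seq 'I_n, size Q <= k /\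
    forall (G' : graph n) (tr' : seq (event n)),
      {in Q, adj G' =1 adj G} -> run G' s tr' -> take k tr' = take k tr.
Proof.
move=> r; elim: r k => {s tr}
  [s s' tr e _ IH|s v c tr e _ IH|s v w c tr e _ IH|s s' tr e _ IH
  |s t s' tr e _ IH|s e] [|k];
  try by exists [::]; split=> // G' tr' _ _; rewrite !take0.
- have [Q [sQ IHQ]] := IH k; exists Q; split; first exact: leqW.
  (* Inversion of [r']: as [step] is a function, only the constructor that matches [e] survives. *)
  move=> G' tr' GG r'; case: r' e => *; try congruence.
  by rewrite /=; congr cons; apply: (IHQ G') => //; congruence.
- have [Q [sQ IHQ]] := IH k; exists (v :: Q); split=> // G' tr' GG r'.
  have Gv : adj G' v = adj G v by apply: GG; rewrite mem_head.
  have GQ : {in Q, adj G' =1 adj G}.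
    by move=> x xQ; apply: GG; rewrite inE xQ orbT.
  case: r' e => *; try congruence.
  by rewrite /=; congr cons; apply: (IHQ G') => //; congruence.
- have [Q [sQ IHQ]] := IH k; exists (v :: Q); split=> // G' tr' GG r'.
  have Gv : next_neighbor G' v w = next_neighbor G v w.
    by rewrite /next_neighbor GG ?mem_head.
  have GQ : {in Q, adj G' =1 adj G}.
    by move=> x xQ; apply: GG; rewrite inE xQ orbT.
  case: r' e => *; try congruence.
  by rewrite /=; congr cons; apply: (IHQ G') => //; congruence.
- have [Q [sQ IHQ]] := IH k; exists Q; split; first exact: leqW.
  move=> G' tr' GG r'; case: r' e => *; try congruence.
  by rewrite /=; congr cons; apply: (IHQ G') => //; congruence.
- have [Q [sQ IHQ]] := IH k; exists Q; split; first exact: leqW.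
  move=> G' tr' GG r'; case: r' e => *; try congruence.
  rewrite /=; congr cons; first congruence.
  by apply: (IHQ G') => //; congruence.
- exists [::]; split=> // G' tr' _ r'; case: r' e => *; try congruence.
Qed.

(** Applied twice to a correct trace, this isolates its two initial blocks of ticks, before
    [Started] and before the first output. *)
Lemma filter_tick_cons (n : nat) (tr l : seq (event n)) (e : event n) :
  [seq x <- tr | ~~ is_tick x] = e :: l ->
  exists i tr', [/\ tr = nseq i Tick ++ e :: tr', ~~ is_tick e
                  & [seq x <- tr' | ~~ is_tick x] = l].
Proof.
elim: tr => //= x tr IH; case: x => [|||] /=.
  by move=> /IH[i [tr' [-> ne fl]]]; exists i.+1, tr'.
all: by [move=> [<- <-]; exists 0, tr | move=> t [<- <-]; exists 0, tr].
Qed.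

Lemma milestones_cons (n : nat) (e : event n) (tr : seq (event n)) :
  milestones (e :: tr) =
  (if is_tick e then [::] else [:: 0]) ++ [seq i.+1 | i <- milestones tr].
Proof.
rewrite /milestones /= (iotaDl 1 0) filter_map.
by case: (is_tick e).
Qed.

Lemma milestones_nseq (n : nat) (i : nat) (tr : seq (event n)) :
  milestones (nseq i Tick ++ tr) = [seq i + j | j <- milestones tr].
Proof.
elim: i => [|i IH]; first by rewrite map_id.
by rewrite /= milestones_cons /= IH -map_comp.
Qed.

(** The first two milestones are at positions [i] and [i + l + 1], so the gap [l + 1] enters the
    maximum. *)
Lemma delay_first (n i l : nat) (t : triple n) (tr : seq (event n)) :
  l < delay (nseq i Tick ++ Started :: nseq l Tick ++
             Emitted t :: tr).
Proof.
rewrite /delay !(milestones_nseq, milestones_cons) /= big_cons /=.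
by apply: leq_trans (leq_maxl _ _); lia.
Qed.

Lemma preprocessing_time_nseq (n i : nat) (tr : seq (event n)) :
  preprocessing_time (nseq i Tick ++ Started :: tr) = i.
Proof. by rewrite /preprocessing_time; elim: i => //= i ->. Qed.

Lemma dist_le_trans : transitive dist_le.
Proof. by move=> [y|] [x|] [z|] //=; apply: leq_trans. Qed.

Lemma two_notin (n : nat) (Q : seq 'I_n) :
  size Q + 2 <= n -> exists a b, [/\ a \notin Q, b \notin Q & a != b].
Proof.
move=> sQ; have : 1 < #|[predC Q]|.
  have := cardC (mem Q); rewrite card_ord => cQ.
  by rewrite -(leq_add2l #|mem Q|) cQ (leq_trans _ sQ) // leq_add2r card_size.
by move=> /card_gt1P[a [b [aQ bQ ab]]]; exists a, b; split.
Qed.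

(** The first output is over after at most [p n + d n + 1] time units. If [n] exceeded
    [p n + d n + 2], two vertices would still be unqueried. *)
Lemma preprocessing_delay_lower_bound (A : algorithm) (p d : nat -> nat) :
  solves_sorted_no_self_APSD A -> preprocessing_bound A p -> delay_bound A d ->
  forall n, 1 < n -> n <= p n + d n + 2.
Proof.
move=> sol pb db n n1; rewrite leqNgt; apply/negP => pdn.
have [tr [s [ex ftr [_ sP _]]]] := sol n (empty_graph n).
(* Since [1 < n], there is a pair of distinct vertices to report, so a first output exists. *)
have [[[u v] D] [s1 sE]] : exists t s1, s = t :: s1.
  have [a [b [_ _ ab]]] := @two_notin n [::] n1.
  have /sP : a != b /\ None = dist (empty_graph n) a b.
    by rewrite dist_empty_graph.
  by case: (s) => // t s1 _; exists t, s1.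
move: ftr sP; rewrite {s}sE => ftr sP.
have D0 : D = None.
  have /sP[uv ->] : (u, v, D) \in (u, v, D) :: s1 by rewrite mem_head.
  exact: dist_empty_graph.
have [i [tr1 [tr_i _ ftr1]]] := filter_tick_cons _ _ _ _ ftr.
have [l [tr2 [tr1_l _ _]]] := filter_tick_cons _ _ _ _ ftr1.
have := pb _ _ _ ex; have := db _ _ _ ex.
rewrite {1}tr_i tr_i tr1_l preprocessing_time_nseq => dl ip.
have ld := leq_trans (delay_first _ _ _ _ _) dl.
(* The prefix up to and including the first output: [i + l] ticks, [Started] and [Emitted]. *)
have [Q [sQ agree]] := run_agree _ _ _ _ _ (i + l + 2) ex.
have [a [b [aQ bQ ab]]] : exists a b, [/\ a \notin Q, b \notin Q & a != b].
  by apply: two_notin; lia.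
have [tr' [s' [ex' ftr' [_ s'P s'_sorted]]]] := sol n (single_edge n a b ab).
have tk : take (i + l + 2) tr' = take (i + l + 2) tr.
  (* The two graphs differ only in the lists of [a] and [b], both outside [Q]. *)
  apply: agree ex' => x xQ /=.
  by case: eqVneq xQ aQ => [-> ->//|_]; case: eqVneq bQ => [-> /negbTE->|].
have tk_tr : take (i + l + 2) tr =
    nseq i Tick ++ Started :: nseq l Tick ++ [:: Emitted (u, v, D)].
  rewrite tr_i tr1_l.
  have -> (r : seq (event n)) :
      nseq i Tick ++ Started :: nseq l Tick ++ Emitted (u, v, D) :: r =
      (nseq i Tick ++ Started :: nseq l Tick ++ [:: Emitted (u, v, D)]) ++ r.
    by rewrite -!catA /= -!catA.
  by rewrite take_size_cat // !size_cat /= size_cat !size_nseq /=; lia.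
have [s1' s'E] : exists s1', s' = (u, v, D) :: s1'.
  move: ftr'; rewrite -(cat_take_drop (i + l + 2) tr') tk tk_tr.
  rewrite !(filter_cat, filter_nseq) /= !(filter_cat, filter_nseq) /=.
  by case: (s') => [|t s1'] //= [-> _]; exists s1'.
have : (a, b, dist (single_edge n a b ab) a b) \in s' by apply/s'P.
have abE : edge (single_edge n a b ab) a b by rewrite /edge /= eqxx mem_head.
move: (dist_edge _ _ _ _ abE); case: (dist _ a b) => // e _.
(* The triple of [(a, b)] has a finite distance [e], so it is not the head of [s'] and comes after
   it. Sortedness would then put [None] below [Some e]. *)
rewrite s'E inE D0 => /orP[/eqP//|es1'].
move: s'_sorted; rewrite s'E D0 /= => /(order_path_min dist_le_trans)/allP.
by move=> /(_ (Some e)) /(_ (map_f snd es1')).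
Qed.

Local Open Scope classical_set_scope.
Local Open Scope ring_scope.

Theorem theorem17 (R : realType) :
  ~ exists A : algorithm,
      solves_sorted_no_self_APSD A /\
      exists p d : nat -> nat,
        [/\ preprocessing_bound A p,
            delay_bound A d,
            (fun n : nat => (p n)%:R : R^o) =o_\oo (fun n : nat => n%:R : R^o)
          & (fun n : nat => (d n)%:R : R^o) =o_\oo (fun n : nat => n%:R : R^o)].
Proof.
move=> [A [sol [p [d [pb db po dO]]]]].
(* With [p n] and [d n] both at most [n / 4], the lower bound gives [n <= n / 2 + 2], that is
   [n <= 4]; hence the choice of [N + 5] below. *)
have e0 : 0 < 4^-1 :> R by [].
have [N _ hN] : \forall n \near \oo,
    (p n)%:R <= 4^-1 * n%:R :> R /\ (d n)%:R <= 4^-1 * n%:R :> R.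
  move/eqoP: po => /(_ _ e0) po; move/eqoP: dO => /(_ _ e0) dO.
  near=> n; split.
  - by have : `|(p n)%:R : R^o| <= 4^-1 * `|n%:R : R^o|
      by [near: n; exact: po]; rewrite !normr_nat.
  - by have : `|(d n)%:R : R^o| <= 4^-1 * `|n%:R : R^o|
      by [near: n; exact: dO]; rewrite !normr_nat.
have [pN dN] := hN (N + 5)%N (leq_addr _ _).
have n1 : (1 < N + 5)%N by lia.
have := preprocessing_delay_lower_bound A p d sol pb db _ n1.
have : 0 <= N%:R :> R by [].
rewrite -(ler_nat R) !natrD in pN dN *.
by lra.
Unshelve. all: by end_near.
Qed.
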